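(* Fix $\delta>0$. There exist constants $c_0,C_0>0$ that depend only on $\delta$ such that $$\log\mathbf{P}\{G(m,n)\ge\gamma(m,n)+\sigma(m,n)s\}\le-\frac{4s^{3/2}}{3}+\frac{C_0s^2}{(m+n)^{1/3}}$$ for all $(m,n)\in S_\delta\cap\mathbb{Z}_{>0}^2$ and $s\in[0,c_0(m+n)^{2/3}]$.
   Context: An up-right path is a finite sequence in $\mathbb{Z}^2$ with steps in $\{(1,0),(0,1)\}$; $\Pi_{1,1}^{m,n}$ is the set of up-right paths from $(1,1)$ to $(m,n)$. Let $\{\omega(i,j):i,j\in\mathbb{Z}_{>0}\}$ be independent exponential random variables of rate $1$, and $G(m,n)=\max_{\pi\in\Pi_{1,1}^{m,n}}\sum_{(i,j)\in\pi}\omega(i,j)$ for $m,n\in\mathbb{Z}_{>0}$ (bulk last-passage time). For $x,y>0$: $\gamma(x,y)=(\sqrt{x}+\sqrt{y})^2$ and $\sigma(x,y)=\dfrac{(\sqrt{x}+\sqrt{y})^{4/3}}{x^{1/6}y^{1/6}}$. $S_\delta=\{(x,y)\in\mathbb{R}_{>0}^2:x\ge\delta y,\ y\ge\delta x\}$. *)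

(* Defs.v *)
From HB Require Import structures.
From mathcomp Require Import all_boot all_order all_algebra finmap.
From mathcomp Require Import all_classical all_reals all_analysis.

Set Implicit Arguments.
Unset Strict Implicit.
Unset Printing Implicit Defensive.

Import Order.TTheory GRing.Theory Num.Theory.

Local Open Scope classical_set_scope.
Local Open Scope ring_scope.

(* Mutual independence of the subfamily (X i), i in D: the product rule holds
   for every finite J included in D. *)
Definition mutually_independent (d d' : measure_display) (T : measurableType d)
    (T' : measurableType d') (R : realType) (P : probability T R)
    (I : choiceType) (D : set I) (X : I -> {RV P >-> T'}) : Prop :=
  forall (J : {fset I}) (B : I -> set T'),
    [set` J] `<=` D -> (forall i, measurable (B i)) ->
    P (\bigcap_(i in [set` J]) (X i @^-1` B i)) =
    (\prod_(i <- J) P (X i @^-1` B i))%E.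

Definition has_law (d d' : measure_display) (T : measurableType d)
    (T' : measurableType d') (R : realType) (P : probability T R)
    (X : {RV P >-> T'}) (Q : set T' -> \bar R) : Prop :=
  forall A : set T', measurable A -> distribution P X A = Q A.

(* Lattice points are pairs of natural numbers: up-right paths issued from
   (1, 1) never leave the positive quadrant. *)
Definition up_right_step : rel (nat * nat) :=
  fun p q => (q == (p.1.+1, p.2)) || (q == (p.1, p.2.+1)).

Definition up_right_paths (p q : nat * nat) : set (seq (nat * nat)) :=
  [set pi | exists s, [/\ pi = p :: s, path up_right_step p s & last p s = q]].

Definition positive_quadrant : set (nat * nat) :=
  [set p | (0 < p.1)%N /\ (0 < p.2)%N].

(* For m, n > 0 the supremum is over a finite nonempty set, hence it is a
   maximum: see last_passage_max below. *)
Definition last_passage (R : realType) (w : nat * nat -> R) (m n : nat) : R :=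
  sup [set \sum_(p <- pi) w p | pi in up_right_paths (1, 1)%N (m, n)].

Definition gamma (R : realType) (x y : R) : R :=
  (Num.sqrt x + Num.sqrt y) ^+ 2.

Definition sigma (R : realType) (x y : R) : R :=
  (Num.sqrt x + Num.sqrt y) `^ (4 / 3) / (x `^ (1 / 6) * y `^ (1 / 6)).

Definition cone (R : realType) (delta : R) : set (R * R) :=
  [set z | [/\ 0 < z.1, 0 < z.2, delta * z.2 <= z.1 & delta * z.1 <= z.2]].

Lemma up_right_paths_neq0 (m n : nat) : (0 < m)%N -> (0 < n)%N ->
  up_right_paths (1, 1)%N (m, n) !=set0.
Proof.
case: m => // m _; case: n => // n _.
elim: n => [|n [pi [s [Epi ps ls]]]].
  elim: m => [|m [pi [s [Epi ps ls]]]]; first by exists [:: (1, 1)%N], [::].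
  exists (rcons pi (m.+2, 1)%N), (rcons s (m.+2, 1)%N); split.
  - by rewrite Epi.
  - by rewrite rcons_path ps ls /up_right_step /= eqxx.
  - by rewrite last_rcons.
exists (rcons pi (m.+1, n.+2)), (rcons s (m.+1, n.+2)); split.
- by rewrite Epi.
- by rewrite rcons_path ps ls /up_right_step /= eqxx orbT.
- by rewrite last_rcons.
Qed.

Lemma finite_up_right_paths (p q : nat * nat) :
  finite_set (up_right_paths p q).
Proof.
pose N := (q.1 + q.2)%N.
have bound s p' : path up_right_step p' s ->
    ((last p' s).1 + (last p' s).2 = p'.1 + p'.2 + size s)%N.
  elim: s p' => [|r s IH] p' /=; first by rewrite addn0.
  by case/andP => /orP[] /eqP -> /IH -> /=; rewrite ?addSn ?addnS.
pose U := fix U k (p' : nat * nat) : seq (seq (nat * nat)) :=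
  if k is k'.+1 then
    [:: p'] :: [seq p' :: s | s <- U k' (p'.1.+1, p'.2) ++ U k' (p'.1, p'.2.+1)]
  else [:: [:: p']].
have mem s : forall p' k, path up_right_step p' s -> (size s <= k)%N ->
    p' :: s \in U k p'.
  elim: s => [|r s IH] p' [|k] //=; rewrite ?inE ?eqxx // ltnS.
  move=> /andP[st ps] sk; apply/orP; right; apply: map_f.
  by rewrite mem_cat; case/orP: st => /eqP Er; rewrite -Er IH ?orbT.
apply: (@sub_finite_set _ _ [set` U N p]); last exact: finite_seq.
move=> pi [s [-> ps ls]] /=; apply: mem => //.
by have := bound _ _ ps; rewrite ls -/N => ->; rewrite leq_addl.
Qed.

Lemma last_passage_max (R : realType) (w : nat * nat -> R) (m n : nat) :
  (0 < m)%N -> (0 < n)%N ->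
  (exists2 pi, up_right_paths (1, 1)%N (m, n) pi &
     last_passage w m n = \sum_(p <- pi) w p) /\
  (forall pi, up_right_paths (1, 1)%N (m, n) pi ->
     \sum_(p <- pi) w p <= last_passage w m n).
Proof.
move=> m0 n0.
set A := [set \sum_(p <- pi) w p | pi in up_right_paths (1, 1)%N (m, n)].
have fA : finite_set A by apply/finite_image/finite_up_right_paths.
have A0 : A !=set0.
  by have [pi Hpi] := up_right_paths_neq0 m0 n0; exists (\sum_(p <- pi) w p), pi.
have [s As] := (finite_seqP A).1 fA.
have sn0 : s != [::].
  by case: A0 => a Aa; apply/eqP => s0; move: Aa; rewrite As s0.
have [a sa maxa] : exists2 a, a \in s & forall x, x \in s -> x <= a.
  elim: s sn0 {As} => // x [|y s] IH _.
    by exists x; rewrite ?inE // => z; rewrite inE => /eqP ->.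
  have [//|a sa maxa] := IH; exists (Num.max x a).
    by case: (leP x a); rewrite inE ?sa ?eqxx ?orbT.
  move=> z; rewrite in_cons le_max => /orP[/eqP ->|/maxa ->]; last by rewrite orbT.
  by rewrite lexx.
have Aa : A a by rewrite As.
have ubA : ubound A a by move=> x; rewrite As; apply: maxa.
have supA : sup A = a.
  apply/le_anti/andP; split; first exact: ge_sup.
  by apply: ub_le_sup => //; exists a.
rewrite /last_passage -/A supA; split; first by have [pi Hpi <-] := Aa; exists pi.
by move=> pi Hpi; apply: ubA; exists pi.
Qed.

(* Main.v *)
Require Import Defs.
From HB Require Import structures.
From mathcomp Require Import all_boot all_order all_algebra finmap.
From mathcomp Require Import all_classical all_reals all_analysis.
From mathcomp Require Import measurable_realfun.
From mathcomp Require Import zify ring lra.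
Import numFieldNormedType.Exports.
Import Order.TTheory GRing.Theory Num.Theory.
Set Implicit Arguments.
Unset Strict Implicit.
Unset Printing Implicit Defensive.

Local Open Scope classical_set_scope.
Local Open Scope ring_scope.

(** The upper tail comes from a single exponential Markov inequality whose
parameters are tuned at the end; no limit theorem is involved, so there is no
prefactor to absorb.

For [0 < z <= w < 1], [chernoff_passage] states
  [P (c <= G(m, n)) <= exp (- (w - z) c) (w / z)^m ((1 - z) / (1 - w))^n].
The two last factors are the exponential moment of order [w - z] of a
last-passage time with boundary: put weights of rate [w] on the horizontal axis
and of rate [1 - z] on the vertical axis. Adding a boundary can only increase
passage times. If the horizontal rate were [z], the model would be stationary
(Burke property): the increments on the east side would again be independent of
rate [1 - z], and their exponential moment is a product of [n] explicit
factors. Now the density of the bottom row under [w] is its density under [z]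
times [(w / z)^m] times the exponential of [- (w - z)] times the sum of the row;
so, up to the factor [(w / z)^m], the moment of the whole passage time under [w]
is the moment of its east side alone under [z].

This computation is made on geometric weights, where every expectation is a
countable sum of nonnegative terms and no measurability question arises. There
the Burke property of one corner says that
  [(u, v, t) |-> (t + (u - v)^+, t + (v - u)^+, min (u, v))]
is an involution of [nat ^ 3] that preserves the weight [a^u b^v (ab)^t]
([cornerK], [corner_weight]). Corners compose into rows ([burke_row]), rows into
the east side ([mean_east_mgf]), and [passage_mgf_le] is the moment bound. An
exponential variable [x] of rate 1 is related to a geometric one by
[cell nu x], the integer part of [nu x] ([cell_law]); rounding changes [G] by at
most [(m + n) / nu], independence turns probabilities into iterated sums
([transfer]), and [nu] is sent to infinity.

It remains to choose [w, z = rho +- sqrt s / sigma], where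
[rho = sqrt m / (sqrt m + sqrt n)] is the stationary point of the exponent at
[c = gamma]. In the expansion of [ln ((1 + u) / (1 - u))] the linear terms
cancel [gamma], the cubic terms add up to [2/3 s^(3/2)] by the very definition
of [sigma], and the term [- 2 s^(3/2)] comes from [sigma s] ([rate_le]). The
fifth-order remainder is the error term of the statement ([quintic_le]). *)

(** * Iterated sums against weights on the integers *)

Section Means.
Variable R : realType.
Implicit Types (p : nat -> R) (f g : nat -> \bar R) (F G : seq nat -> \bar R).
Local Open Scope ereal_scope.

Definition mean p f : \bar R := \sum_(0 <= k <oo) (p k)%:E * f k.

Fixpoint mean_seq p m F : \bar R :=
  if m is m'.+1 then mean p (fun k => mean_seq p m' (fun s => F (k :: s)))
  else F [::].

Definition weight p := forall k, (0 <= p k)%R.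

Lemma mean_ge0 p f : weight p -> (forall k, 0 <= f k) -> 0 <= mean p f.
Proof.
by move=> p0 f0; apply: nneseries_ge0 => k _ _; rewrite mule_ge0 ?lee_fin.
Qed.

Lemma eq_mean p f g : f =1 g -> mean p f = mean p g.
Proof. by move=> fg; apply: eq_eseriesr => k _; rewrite fg. Qed.

Lemma le_mean p f g : weight p -> (forall k, 0 <= f k) ->
  (forall k, f k <= g k) -> mean p f <= mean p g.
Proof.
move=> p0 f0 fg; apply: lee_nneseries => [k _ _|k _].
  by rewrite mule_ge0 ?lee_fin.
by rewrite lee_wpmul2l ?lee_fin.
Qed.

Lemma meanZl p f (c : R) : weight p -> (0 <= c)%R -> (forall k, 0 <= f k) ->
  mean p (fun k => c%:E * f k) = c%:E * mean p f.
Proof.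
move=> p0 c0 f0; rewrite -nneseriesZl; last first.
  by move=> k _; rewrite mule_ge0 ?lee_fin.
by apply: eq_eseriesr => k _; rewrite muleCA.
Qed.

(** Tonelli for series: the only analytic fact behind the Burke property. *)
Lemma exchange_mean p p' (f : nat -> nat -> \bar R) :
  weight p -> weight p' -> (forall k l, 0 <= f k l) ->
  mean p (fun k => mean p' (f k)) = mean p' (fun l => mean p (f ^~ l)).
Proof.
move=> p0 p'0 f0.
transitivity (\sum_(0 <= k <oo) \sum_(0 <= l <oo) (p k * p' l)%:E * f k l).
  apply: eq_eseriesr => k _; rewrite -nneseriesZl; last first.
    by move=> l _; rewrite mule_ge0 ?lee_fin.
  by apply: eq_eseriesr => l _; rewrite muleA.
rewrite nneseries_interchange; last first.
  by move=> k l; rewrite mule_ge0 ?lee_fin ?mulr_ge0.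
apply: eq_eseriesr => l _; rewrite -nneseriesZl; last first.
  by move=> k _; rewrite mule_ge0 ?lee_fin.
by apply: eq_eseriesr => k _; rewrite muleA -EFinM mulrC.
Qed.

Lemma mean_seq_ge0 p m F : weight p -> (forall s, 0 <= F s) ->
  0 <= mean_seq p m F.
Proof.
move=> p0; elim: m F => [|m IH] F F0 //=.
by apply: mean_ge0 => // k; apply: IH.
Qed.

Lemma eq_mean_seq p m F G : (forall s, size s = m -> F s = G s) ->
  mean_seq p m F = mean_seq p m G.
Proof.
elim: m F G => [|m IH] F G FG /=; first exact: FG.
by apply: eq_mean => k; apply: IH => s sm; apply: FG; rewrite /= sm.
Qed.

Lemma le_mean_seq p m F G : weight p -> (forall s, 0 <= F s) ->
  (forall s, size s = m -> F s <= G s) -> mean_seq p m F <= mean_seq p m G.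
Proof.
move=> p0; elim: m F G => [|m IH] F G F0 FG /=; first exact: FG.
apply: le_mean => // k; first exact: mean_seq_ge0.
by apply: IH => // s sm; apply: FG; rewrite /= sm.
Qed.

Lemma mean_seqZl p m F (c : R) : weight p -> (0 <= c)%R ->
  (forall s, 0 <= F s) ->
  mean_seq p m (fun s => c%:E * F s) = c%:E * mean_seq p m F.
Proof.
move=> p0 c0; elim: m F => [|m IH] F F0 //=.
rewrite -meanZl //; last by move=> k; exact: mean_seq_ge0.
by apply: eq_mean => k; rewrite IH.
Qed.

Lemma exchange_mean_seq_mean p p' m (f : seq nat -> nat -> \bar R) :
  weight p -> weight p' -> (forall s l, 0 <= f s l) ->
  mean_seq p m (fun s => mean p' (f s)) =
  mean p' (fun l => mean_seq p m (f ^~ l)).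
Proof.
move=> p0 p'0; elim: m f => [|m IH] f f0 //=.
rewrite -exchange_mean //; last by move=> k l; exact: mean_seq_ge0.
by apply: eq_mean => k; rewrite -IH.
Qed.

Lemma mean_seqD p m m' F :
  mean_seq p (m + m') F =
  mean_seq p m (fun s => mean_seq p m' (fun s' => F (s ++ s'))).
Proof.
elim: m F => [|m IH] F //=.
by apply: eq_mean => k; rewrite IH.
Qed.

Definition probability_weight p := weight p /\ mean p (cst 1) = 1.

Lemma mean_cst p (c : \bar R) : probability_weight p -> 0 <= c ->
  mean p (cst c) = c.
Proof.
move=> [p0 p1] c0.
rewrite -[RHS]mule1 -p1 /mean.
case: c c0 => [r r0| |//].
- rewrite -nneseriesZl; last by move=> i _; rewrite mule_ge0 ?lee_fin.
  by apply: eq_eseriesr => k _; rewrite /= mule1 muleC.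
- move=> _.
  have p1' : mean p (cst 1) != 0 by rewrite p1 gt_eqF.
  rewrite -/(mean p (cst 1)) p1 mule1; apply/eqP; rewrite -leye_eq.
  (* A weight of total mass 1 charges some integer, so an infinite constant has
     an infinite mean. *)
  have [k pk] : exists k, (0 < p k)%R.
    apply: contrapT => nk; move/eqP: p1'; apply; apply: eseries0 => k _ _ /=.
    rewrite mule1; congr EFin; apply/eqP; rewrite eq_le p0 andbT leNgt.
    by apply/negP => ?; apply: nk; exists k.
  rewrite nneseries_esumT; last by move=> ?; rewrite mule_ge0 ?lee_fin ?leey.
  apply: esum_ge; exists [set k]; first by split.
  by rewrite fsbig_set1 /= gt0_muley ?lte_fin.
Qed.

Lemma mean_seq_cst p m (c : \bar R) : probability_weight p -> 0 <= c ->
  mean_seq p m (cst c) = c.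
Proof.
move=> p1 c0; elim: m => [|m IH] //=.
by rewrite -[RHS](mean_cst p1 c0); apply: eq_mean => k; exact: IH.
Qed.

(** Change of measure: tilting every coordinate by [k |-> exp (t k)] turns the
weight [p] into [p'] up to the constant [c], once per coordinate. *)
Lemma mean_seq_tilt p p' (t c : R) m F :
  weight p -> weight p' -> (0 <= c)%R ->
  (forall k, (p k * expR (t * k%:R) = c * p' k)%R) ->
  (forall s, 0 <= F s) ->
  mean_seq p m (fun s => (expR (t * (sumn s)%:R))%:E * F s) =
  (c ^+ m)%:E * mean_seq p' m F.
Proof.
move=> p0 p'0 c0 pp'; elim: m F => [|m IH] F F0 /=.
  by rewrite mulr0 expR0.
rewrite exprS EFinM -muleA -meanZl //; last first.
- by move=> k; exact: mean_seq_ge0.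
- exact: exprn_ge0.
rewrite -meanZl //; last first.
  by move=> k; rewrite mule_ge0 ?lee_fin ?exprn_ge0 //; exact: mean_seq_ge0.
apply: eq_eseriesr => k _.
rewrite -IH //.
rewrite (_ : mean_seq _ _ _ = (expR (t * k%:R))%:E *
  mean_seq p m (fun s => (expR (t * (sumn s)%:R))%:E * F (k :: s))); last first.
  rewrite -mean_seqZl ?expR_ge0 //; last first.
    by move=> s; rewrite mule_ge0 ?lee_fin ?expR_ge0.
  by apply: eq_mean_seq => s _; rewrite muleA -EFinM -expRD natrD mulrDr.
by rewrite muleA -EFinM pp' EFinM -muleA muleCA.
Qed.

End Means.

(** * The Burke property for geometric weights *)

Section Burke.
Variable R : realType.
Local Open Scope ereal_scope.

Definition geometric_weight (r : R) (k : nat) : R := ((1 - r) * r ^+ k)%R.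

Lemma geometric_weight_ge0 (r : R) : (0 <= r <= 1)%R ->
  weight (geometric_weight r).
Proof. by move=> /andP[r0 r1] k; rewrite mulr_ge0 ?exprn_ge0 ?subr_ge0. Qed.

Lemma eseries_geometric (a r : R) : (0 <= r < 1)%R ->
  \sum_(0 <= k <oo) (a * r ^+ k)%:E = (a / (1 - r))%:E.
Proof.
move=> /andP[r0 r1].
apply/cvg_lim => //.
rewrite (_ : (fun n => _) = EFin \o series (geometric a r)); last first.
  by apply/funext => n; rewrite /series /= sumEFin.
apply/cvg_EFin; first by near=> n.
by apply: cvg_geometric_series; rewrite ger0_norm.
Unshelve. all: by end_near.
Qed.

Lemma probability_geometric_weight (r : R) : (0 <= r < 1)%R ->
  probability_weight (geometric_weight r).
Proof.
move=> /andP[r0 r1]; split.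
  by apply: geometric_weight_ge0; rewrite r0 ltW.
rewrite /mean (eq_eseriesr (g := fun k => ((1 - r) * r ^+ k)%:E)); last first.
  by move=> k _; rewrite mule1.
by rewrite eseries_geometric ?r0 // divff // subr_eq0 gt_eqF.
Qed.

Lemma mean3_esum (p1 p2 p3 : nat -> R) (f : nat -> nat -> nat -> \bar R) :
  weight p1 -> weight p2 -> weight p3 -> (forall i j k, 0 <= f i j k) ->
  mean p1 (fun i => mean p2 (fun j => mean p3 (fun k => f i j k))) =
  \esum_(x in [set: nat * nat * nat])
    ((p1 x.1.1 * p2 x.1.2 * p3 x.2)%:E * f x.1.1 x.1.2 x.2).
Proof.
move=> p10 p20 p30 f0.
pose w i j k := ((p1 i * p2 j * p3 k)%:E * f i j k).
have w0 i j k : 0 <= w i j k by rewrite mule_ge0 ?lee_fin ?mulr_ge0.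
have -> : mean p1 (fun i => mean p2 (fun j => mean p3 (fun k => f i j k))) =
    \esum_(i in [set: nat]) \esum_(j in [set: nat]) \esum_(k in [set: nat])
      w i j k.
  rewrite -nneseries_esumT; last first.
    by move=> i; apply: esum_ge0 => j _; exact: esum_ge0.
  apply: eq_eseriesr => i _.
  rewrite -nneseries_esumT; last by move=> j; exact: esum_ge0.
  rewrite -nneseriesZl; last by move=> j _; rewrite mule_ge0 ?lee_fin ?mean_ge0.
  apply: eq_eseriesr => j _.
  rewrite -nneseries_esumT // muleA -EFinM.
  rewrite -nneseriesZl; last by move=> k _; rewrite mule_ge0 ?lee_fin.
  by apply: eq_eseriesr => k _; rewrite muleA -EFinM.
rewrite esum_esum; last by move=> i j _ _; exact: esum_ge0.
rewrite esum_esum //.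
by congr esum; apply/seteqP; split => // -[[]].
Qed.

(** The two incoming increments [u], [v] of a unit square and its weight [w] are
mapped to the two outgoing increments; the third component [minn u v] is the
information lost, and keeping it makes the map invertible. *)
Definition corner (x : nat * nat * nat) : nat * nat * nat :=
  let: (u, v, w) := x in ((w + (u - v))%N, (w + (v - u))%N, minn u v).

Lemma cornerK : involutive corner.
Proof.
move=> [[u v] w] /=; congr (_, _, _); rewrite ?subnDl ?minnE; lia.
Qed.

(** The factor of the third coordinate is [a * b], so the product only depends on
[u + w] and [v + w], which [corner] preserves. *)
Lemma corner_weight (a b : R) (u v w : nat) :
  let: (u', v', w') := corner (u, v, w) in
  (geometric_weight a u' * geometric_weight b v' * geometric_weight (a * b) w'
   = geometric_weight a u * geometric_weight b v * geometric_weight (a * b) w)%R.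
Proof.
rewrite /corner /geometric_weight !exprMn.
set u' := (w + _)%N; set v' := (w + _)%N; set w' := minn u v.
have eu : (a ^+ u' * a ^+ w' = a ^+ u * a ^+ w)%R.
  by rewrite -!exprD; congr (_ ^+ _)%R; rewrite /u' /w'; lia.
have ev : (b ^+ v' * b ^+ w' = b ^+ v * b ^+ w)%R.
  by rewrite -!exprD; congr (_ ^+ _)%R; rewrite /v' /w'; lia.
transitivity ((1 - a) * (1 - b) * (1 - a * b) *
  ((a ^+ u' * a ^+ w') * (b ^+ v' * b ^+ w')))%R; first by ring.
by rewrite eu ev; ring.
Qed.

(** Reindexing by the weight-preserving involution [corner] makes the summand
independent of the third coordinate, which then sums to 1. *)
Lemma burke_corner (a b : R) (f : nat -> nat -> \bar R) :
  (0 <= a < 1)%R -> (0 <= b < 1)%R -> (forall i j, 0 <= f i j) ->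
  let p := geometric_weight in
  mean (p a) (fun u => mean (p b) (fun v => mean (p (a * b)%R) (fun w =>
    f (w + (u - v))%N (w + (v - u))%N))) =
  mean (p a) (fun u => mean (p b) (fun v => f u v)).
Proof.
move=> a01 b01 f0 p.
have ab01 : (0 <= a * b < 1)%R.
  by case/andP: a01 => a0 a1; case/andP: b01 => b0 b1; rewrite mulr_ge0 ?mulr_ilt1.
have [[pa _] [pb _] [pab pab1]] := And3 (probability_geometric_weight a01)
  (probability_geometric_weight b01) (probability_geometric_weight ab01).
rewrite mean3_esum //.
transitivity (mean (p a) (fun u => mean (p b) (fun v =>
    mean (p (a * b)%R) (cst (f u v))))); last first.
  by do 2!apply: eq_mean => ?; exact: mean_cst.
rewrite mean3_esum // [RHS](reindex_esum [set: nat * nat * nat] _ corner).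
  apply: eq_esum => -[[u v] w] _.
  by have := corner_weight a b u v w; rewrite /corner /= => ->.
by split => // [x y _ _|x _]; [exact: (can_inj cornerK)|
  exists (corner x) => //; rewrite cornerK].
Qed.

(** One row of the lattice, read from west to east: [I] lists the horizontal
increments below the row, [J] is the vertical increment on its west side and [W]
its weights. The result is the horizontal increments above the row and the
vertical increment on its east side. *)
Fixpoint row_map (J : nat) (I W : seq nat) : seq nat * nat :=
  match I, W with
  | i :: I', w :: W' =>
    let r := row_map (w + (J - i)) I' W' in ((w + (i - J))%N :: r.1, r.2)
  | _, _ => ([::], J)
  end.

(** Stationarity across a row. After [burke_corner] at the first square, the
vertical increment entering the second square has the same law as [J] and is
independent of the first outgoing increment, so the induction continues. *)
Lemma burke_row (a b : R) m (f : seq nat -> nat -> \bar R) :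
  (0 <= a < 1)%R -> (0 <= b < 1)%R -> (forall s j, 0 <= f s j) ->
  let p := geometric_weight in
  mean (p a) (fun J => mean_seq (p b) m (fun I =>
    mean_seq (p (a * b)%R) m (fun W =>
      f (row_map J I W).1 (row_map J I W).2))) =
  mean (p a) (fun J => mean_seq (p b) m (fun I => f I J)).
Proof.
move=> a01 b01 f0 p; move: f f0.
have ab01 : (0 <= a * b < 1)%R.
  by case/andP: a01 => a0 a1; case/andP: b01 => b0 b1; rewrite mulr_ge0 ?mulr_ilt1.
have [[pa _] [pb _] [pab _]] := And3 (probability_geometric_weight a01)
  (probability_geometric_weight b01) (probability_geometric_weight ab01).
elim: m => [|m IH] f f0 //=.
pose h J i := mean_seq (p b) m (fun I => mean_seq (p (a * b)%R) m (fun W =>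
    f (i :: (row_map J I W).1) (row_map J I W).2)).
have h0 J i : 0 <= h J i by do 2!apply: mean_seq_ge0 => // ?.
transitivity (mean (p a) (fun u => mean (p b) (fun v => mean (p (a * b)%R)
    (fun w => h (w + (u - v))%N (w + (v - u))%N)))).
  apply: eq_mean => u; apply: eq_mean => v.
  by rewrite exchange_mean_seq_mean // => s l; exact: mean_seq_ge0.
rewrite burke_corner // exchange_mean // [RHS]exchange_mean //; last first.
  by move=> *; exact: mean_seq_ge0.
by apply: eq_mean => i; exact: (IH (fun s => f (i :: s))).
Qed.

End Burke.

(** * Comparison with the stationary model *)

Section StationaryBound.
Variable R : realType.
Local Open Scope ereal_scope.

(** The recursion [G(i, j) = w(i, j) + max (G(i-1, j), G(i, j-1))] along a row:
[g] lists the passage times below and [l] is the one on the west. *)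
Fixpoint passage_row (l : nat) (g W : seq nat) : seq nat :=
  match g, W with
  | x :: g', w :: W' => let y := (w + maxn l x)%N in y :: passage_row y g' W'
  | _, _ => [::]
  end.

(** Exponential moment of the passage time at the last site after [n] more rows
of geometric weights, starting from the row [g] of passage times. *)
Fixpoint passage_mgf (q t : R) m n (g : seq nat) : \bar R :=
  if n is n'.+1 then
    mean_seq (geometric_weight q) m (fun W =>
      passage_mgf q t m n' (passage_row 0 g W))
  else (expR (t * (last 0%N g)%:R))%:E.

(** Exponential moment of the sum of the [n] vertical increments on the east
side, given the horizontal increments [I] at the bottom. *)
Fixpoint east_mgf (a q t : R) m n (I : seq nat) : \bar R :=
  if n is n'.+1 then
    mean (geometric_weight a) (fun J => mean_seq (geometric_weight q) m
      (fun W => let r := row_map J I W in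
        (expR (t * r.2%:R))%:E * east_mgf a q t m n' r.1))
  else 1.

Lemma size_row_map J I W : size (row_map J I W).1 = minn (size I) (size W).
Proof.
by elim: I J W => [|x g IH] l [|w W] //=; rewrite IH minnSS.
Qed.

Lemma passage_mgf_ge0 q t m n g : (0 <= q <= 1)%R -> 0 <= passage_mgf q t m n g.
Proof.
move=> q01; elim: n g => [|n IH] g /=; first by rewrite lee_fin expR_ge0.
by apply: mean_seq_ge0 => //; exact: geometric_weight_ge0.
Qed.

Lemma east_mgf_ge0 a q t m n I : (0 <= a <= 1)%R -> (0 <= q <= 1)%R ->
  0 <= east_mgf a q t m n I.
Proof.
move=> a01 q01; elim: n I => [|n IH] I //=.
apply: mean_ge0 => [|J]; first exact: geometric_weight_ge0.
apply: mean_seq_ge0 => [|W]; first exact: geometric_weight_ge0.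
by rewrite mule_ge0 ?lee_fin ?expR_ge0.
Qed.

(** With stationary bottom increments each row contributes an independent
geometric increment on the east side, and leaves stationary increments above. *)
Lemma mean_east_mgf (a b t : R) m n :
  (0 <= a < 1)%R -> (0 <= b < 1)%R -> (0 <= a * expR t < 1)%R ->
  mean_seq (geometric_weight b) m (east_mgf a (a * b) t m n) =
  (((1 - a) / (1 - a * expR t)) ^+ n)%:E.
Proof.
move=> a01 b01 at01.
have [a01' b01'] : (0 <= a <= 1)%R /\ (0 <= b <= 1)%R.
  by case/andP: a01 => -> /ltW ->; case/andP: b01 => -> /ltW ->.
have ab01' : (0 <= a * b <= 1)%R.
  by case/andP: a01' => *; case/andP: b01' => *; rewrite mulr_ge0 ?mulr_ile1.
have c0 : (0 <= (1 - a) / (1 - a * expR t))%R.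
  case/andP: a01 => _ a1; case/andP: at01 => _ at1.
  by rewrite divr_ge0 // subr_ge0 ltW.
have pa := geometric_weight_ge0 a01'.
have pb := geometric_weight_ge0 b01'.
elim: n => [|n IH] /=.
  by rewrite expr0 mean_seq_cst //; exact: probability_geometric_weight.
rewrite exchange_mean_seq_mean //; last first.
  move=> s l; apply: mean_seq_ge0 => [|W]; first exact: geometric_weight_ge0.
  by rewrite mule_ge0 ?lee_fin ?expR_ge0 ?east_mgf_ge0.
rewrite (burke_row m (f := fun s j => (expR (t * j%:R))%:E *
  east_mgf a (a * b) t m n s)) //; last first.
  by move=> s j; rewrite mule_ge0 ?lee_fin ?expR_ge0 ?east_mgf_ge0.
transitivity (mean (geometric_weight a) (fun J =>
  (((1 - a) / (1 - a * expR t)) ^+ n)%:E * (expR (t * J%:R))%:E)).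
  apply: eq_mean => J; rewrite mean_seqZl ?expR_ge0 //.
    by rewrite IH muleC.
  by move=> s; rewrite east_mgf_ge0.
rewrite meanZl ?exprn_ge0 //.
rewrite exprSr EFinM; congr (_ * _).
rewrite -eseries_geometric // /mean; apply: eq_eseriesr => k _.
by rewrite -EFinM /geometric_weight exprMn -mulrA -expRM_natl (mulrC t).
Qed.

(** Monotonicity: the partial sums [scanl addn c I] are the passage times of the
model with boundary, [c] being its value at the west corner; they dominate the
model without boundary and keep doing so above the row. *)
Lemma passage_row_le l c J g I W : all2 leq g (scanl addn c I) ->
  (l <= c + J)%N ->
  all2 leq (passage_row l g W) (scanl addn (c + J)%N (row_map J I W).1).
Proof.
elim: g l c J I W => [|x g IH] l c J [|i I] [|w W] //= /andP[xi gI] lcJ.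
have e : (c + J + (w + (i - J)) = c + i + (w + (J - i)))%N by lia.
apply/andP; split; first lia.
by rewrite e; apply: IH => //; lia.
Qed.

(** Both sides are the increment from the south-west to the north-east corner of
the row, computed along its two boundary paths. *)
Lemma row_map_sumn J I W : size I = size W ->
  (J + sumn (row_map J I W).1 = sumn I + (row_map J I W).2)%N.
Proof.
elim: I J W => [|i I IH] J [|w W] //=; first by rewrite addn0.
by move=> [/IH e]; have := e (w + (J - i))%N; lia.
Qed.

Lemma last_scanl_leq g c I :
  all2 leq g (scanl addn c I) -> (last 0 g <= c + sumn I)%N.
Proof.
case: g I => [|x g] [|i I] //= /andP[].
elim: g x c i I => [|y g IH] x c i [|j I] //= xi.
  by rewrite addn0.
by case/andP=> yj /(IH _ _ _ _ yj); rewrite -addnA.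
Qed.

(** The passage time with boundary at the north-east corner is [c], plus the
bottom row, plus the east side. The comparison holds for every value of the west
increments, hence also on average over them. *)
Lemma passage_le_east (a q t : R) m n c g I :
  (0 <= a < 1)%R -> (0 <= q <= 1)%R -> (0 <= t)%R -> size I = m ->
  all2 leq g (scanl addn c I) ->
  passage_mgf q t m n g <=
    (expR (t * (c + sumn I)%:R))%:E * east_mgf a q t m n I.
Proof.
move=> a01 q01 t0.
have a01' : (0 <= a <= 1)%R by case/andP: a01 => -> /ltW ->.
have pq := geometric_weight_ge0 q01.
have pa := geometric_weight_ge0 a01'.
elim: n c g I => [|n IH] c g I sI gI /=.
  rewrite mule1 lee_fin ler_expR ler_wpM2l // ler_nat.
  exact: last_scanl_leq.
rewrite -meanZl ?expR_ge0 //; last first.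
  move=> J; apply: mean_seq_ge0 => // W.
  by rewrite mule_ge0 ?lee_fin ?expR_ge0 ?east_mgf_ge0.
rewrite -[leLHS](mean_cst (probability_geometric_weight a01)); last first.
  by apply: mean_seq_ge0 => // W; exact: passage_mgf_ge0.
apply: le_mean => // J; rewrite /cst.
  by apply: mean_seq_ge0 => // W; exact: passage_mgf_ge0.
rewrite -mean_seqZl ?expR_ge0 //; last first.
  by move=> W; rewrite mule_ge0 ?lee_fin ?expR_ge0 ?east_mgf_ge0.
apply: le_mean_seq => // W; first exact: passage_mgf_ge0.
move=> sW.
apply: (le_trans (IH (c + J)%N _ (row_map J I W).1 _ _)).
- by rewrite size_row_map sI sW minnn.
- exact: passage_row_le.
rewrite muleA -EFinM -expRD -mulrDr -natrD.
suff -> : (c + J + sumn (row_map J I W).1 =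
           c + sumn I + (row_map J I W).2)%N by [].
have := @row_map_sumn J I W; rewrite sI sW => /(_ erefl); lia.
Qed.

(** Average [passage_le_east] over bottom increments of parameter
[b * expR (- t)]: tilting turns them into the stationary ones of parameter [b],
at the price of the first factor. *)
Lemma passage_mgf_le (a b t : R) m n :
  (0 <= t)%R -> (0 <= a < 1)%R -> (0 <= b < 1)%R -> (0 <= a * expR t < 1)%R ->
  passage_mgf (a * b) t m n (nseq m 0%N) <=
  (((1 - b * expR (- t)) / (1 - b)) ^+ m *
   ((1 - a) / (1 - a * expR t)) ^+ n)%:E.
Proof.
move=> t0 a01 b01 at01.
have [/andP[a0 a1] /andP[b0 b1]] := conj a01 b01.
have ab01' : (0 <= a * b <= 1)%R by rewrite mulr_ge0 // mulr_ile1 // ltW.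
have bt01 : (0 <= b * expR (- t) < 1)%R.
  rewrite mulr_ge0 ?expR_ge0 //= (le_lt_trans _ b1) // ler_piMr //.
  by rewrite -expR0 ler_expR oppr_le0.
have pw := probability_geometric_weight bt01.
have pb := probability_geometric_weight b01.
have gI c I : size I = m -> all2 leq (nseq m 0%N) (scanl addn c I).
  by elim: m c I => [|m IH] c [|i I] //= [sI]; exact: IH.
rewrite -[leLHS](mean_seq_cst m pw); last exact: passage_mgf_ge0.
rewrite EFinM -(mean_east_mgf m n a01 b01 at01).
have tilt k : (geometric_weight (b * expR (- t)) k * expR (t * k%:R) =
    (1 - b * expR (- t)) / (1 - b) * geometric_weight b k)%R.
  rewrite /geometric_weight exprMn -expRM_natl.
  have b1' : (1 - b)%R != 0%R by rewrite subr_eq0 gt_eqF.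
  have e : (expR (k%:R * - t) * expR (t * k%:R) = 1 :> R)%R.
    by rewrite -expRD -[RHS]expR0; congr expR; ring.
  by rewrite mulrA divfK // -!mulrA; congr (_ * _)%R; rewrite e mulr1.
have c0 : (0 <= (1 - b * expR (- t)) / (1 - b))%R.
  by case/andP: bt01 => _ w1; rewrite divr_ge0 // subr_ge0 ltW.
have east0 I : 0 <= east_mgf a (a * b) t m n I.
  by apply: east_mgf_ge0 => //; rewrite a0 ltW.
have := mean_seq_tilt m pw.1 pb.1 c0 tilt east0.
move=> <-; apply: le_mean_seq => [|s|I sI]; first by case: pw.
- exact: passage_mgf_ge0.
- by have := passage_le_east n a01 ab01' t0 sI (gI 0%N I sI); rewrite add0n.
Qed.

End StationaryBound.

(** * From exponential to geometric weights *)

Section Discretisation.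
Variable R : realType.

Definition cell (nu x : R) : nat := Num.truncn (nu * x).

Lemma le_cell (nu x : R) : 0 < nu -> x <= (cell nu x).+1%:R / nu.
Proof.
by move=> nu0; rewrite ler_pdivlMr // mulrC ltW // /cell truncnS_gt.
Qed.

Lemma cell_leE (nu : R) k : 0 < nu ->
  [set x : R | (cell nu x <= k)%N] = `]-oo, (k.+1%:R / nu)[%classic.
Proof.
move=> nu0; apply/seteqP; split => x /=;
  by rewrite in_itv /= ltr_pdivlMr // truncn_le_nat mulrC.
Qed.

Lemma exponential_prob_Nyo (c : R) : 0 < c ->
  exponential_prob (1 : R) `]-oo, c[ = (1 - expR (- c))%:E.
Proof.
move=> c0.
have mpdf (A : set R) : measurable_fun A (fun x : R => (exponential_pdf (1 : R) x)%:E).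
  by apply: measurable_funTS; apply/measurable_EFinP; exact: measurable_exponential_pdf.
rewrite /exponential_prob.
have -> : `]-oo, c[%classic = `]-oo, (0 : R)[ `|` `[(0 : R), c[.
  apply/seteqP; split => x /=; rewrite !in_itv /=.
    by case: (ltP x 0) => x0 xc; [left|right].
  by move=> [x0|/andP[]//]; exact: lt_trans c0.
rewrite ge0_integral_setU //=; last 2 first.
- by move=> x _; rewrite lee_fin exponential_pdf_ge0.
- apply/disj_setPS => x /= []; rewrite !in_itv /= => x0 /andP[/(lt_le_trans x0)].
  by rewrite ltxx.
rewrite integral0_eq ?add0e; last first.
  by move=> x /=; rewrite in_itv /= => x0; rewrite lt0_exponential_pdf.
rewrite integral_itv_bndo_bndc //.
by have := exponential_prob_itv0c 1 c0; rewrite /exponential_prob mulN1r.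
exact: mpdf.
Qed.

Lemma cell_law (nu : R) (d : measure_display) (T : measurableType d)
    (P : probability T R) (X : {RV P >-> R}) (k : nat) : 0 < nu ->
  has_law X (exponential_prob (1 : R)) ->
  P (X @^-1` [set x | cell nu x = k]) =
  (geometric_weight (expR (- nu^-1)) k)%:E.
Proof.
move=> nu0 lawX.
pose A k := [set x : R | (cell nu x <= k)%N].
have mA j : measurable (A j) by rewrite /A cell_leE.
have PA j : distribution P X (A j) = (1 - expR (- nu^-1) ^+ j.+1)%:E.
  rewrite lawX // /A cell_leE // exponential_prob_Nyo ?divr_gt0 //.
  by rewrite -expRM_natl mulrN.
rewrite -[LHS]/(distribution P X [set x | cell nu x = k]) /geometric_weight.
case: k => [|k].
  rewrite (_ : [set x | _] = A 0%N) ?PA ?expr1 ?expr0 ?mulr1 //.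
  by apply/seteqP; split => x /=; rewrite /A /= leqn0 => /eqP.
have -> : [set x | cell nu x = k.+1] = A k.+1 `\` A k.
  apply/seteqP; split => x; rewrite /A /=; first by move=> ->; rewrite ltnn.
  by move=> [xk /negP]; lia.
rewrite measureD //=; last by rewrite -ge0_fin_numE // fin_num_measure.
rewrite setIidr; last by move=> x; rewrite /A /=; lia.
transitivity ((1 - expR (- nu^-1) ^+ k.+2) - (1 - expR (- nu^-1) ^+ k.+1))%:E.
  by rewrite EFinB -!PA.
by congr EFin; rewrite [in _ ^+ k.+2]exprS; ring.
Qed.

Lemma measurable_cell (nu : R) (B : set nat) : 0 < nu ->
  measurable [set x : R | B (cell nu x)].
Proof.
move=> nu0; rewrite (_ : [set x | _] =
    \bigcup_(k in B) [set x : R | cell nu x = k]); last first.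
  by apply/seteqP; split => [x Bx|x [k Bk /= ->]//]; exists (cell nu x).
apply: bigcup_measurable => k _.
have mA j : measurable [set x : R | (cell nu x <= j)%N] by rewrite cell_leE.
case: k => [|k].
  rewrite (_ : [set x | _] = [set x | (cell nu x <= 0)%N]) //.
  by apply/seteqP; split => x /=; rewrite leqn0 => /eqP.
rewrite (_ : [set x | _] = [set x | (cell nu x <= k.+1)%N] `\`
    [set x | (cell nu x <= k)%N]); first exact: measurableD.
apply/seteqP; split => x /=; first by move=> ->; rewrite ltnn.
by move=> [xk /negP]; lia.
Qed.

End Discretisation.

(** * Independence as an iterated sum *)

Section Transfer.
Variables (R : realType) (d : measure_display) (T : measurableType d).
Variables (P : probability T R) (I : choiceType) (D : set I).
Variables (X : I -> {RV P >-> R}) (nu : R).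
Hypothesis nu0 : 0 < nu.
Hypothesis indep : mutually_independent D X.
Hypothesis law : forall i, D i -> has_law (X i) (exponential_prob (1 : R)).

Let p := geometric_weight (expR (- nu^-1) : R).

Let pinned (qs : seq (I * nat)) : set T :=
  [set t | all (fun x => cell nu (X x.1 t) == x.2) qs].

Let pinned_law qs : uniq (unzip1 qs) -> {in unzip1 qs, forall i, D i} ->
  P (pinned qs) = (\prod_(x <- qs) p x.2)%:E.
Proof.
move=> uqs Dqs.
pose val i := nth 0%N (unzip2 qs) (index i (unzip1 qs)).
have valE x : x \in qs -> val x.1 = x.2.
  move=> xqs; rewrite /val.
  have iq : (index x qs < size qs)%N by rewrite index_mem.
  rewrite (_ : x.1 = nth x.1 (unzip1 qs) (index x qs)); last first.
    by rewrite (nth_map x) // nth_index.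
  by rewrite index_uniq ?size_map // (nth_map x) // nth_index.
pose B i := [set x : R | cell nu x = val i].
pose J : {fset I} := [fset i in unzip1 qs]%fset.
have JD : [set` J] `<=` D by move=> i /=; rewrite /J !inE; exact: Dqs.
have mB i : measurable (B i) by exact: (@measurable_cell R nu [set k | k = val i]).
have := indep JD mB.
rewrite (_ : \bigcap_(i in [set` J]) _ = pinned qs); last first.
  apply/seteqP; split => t.
    move=> h; apply/allP => x xqs; apply/eqP.
    have := h x.1; rewrite /B /= valE //; apply.
    by rewrite /J /= !inE map_f.
  move=> /allP h i /=; rewrite /J !inE => /mapP[x xqs ->].
  by rewrite /B /= valE //; apply/eqP/h.
move=> ->.
rewrite (perm_big (unzip1 qs)) /=; last first.
  apply: uniq_perm => // i; by rewrite /J !inE.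
rewrite big_map -prodEFin; apply: eq_big_seq => x xqs.
rewrite /B valE //; apply: cell_law => //; apply: law; apply: Dqs.
exact: map_f.
Qed.

(** Induction on the coordinates not yet pinned down: split the event according
to the value of the next one. Carrying the pinned coordinates along reduces the
base case to the product rule. *)
Let transfer_aux (ps : seq I) qs (F : seq nat -> bool) :
  uniq (unzip1 qs ++ ps) -> {in unzip1 qs ++ ps, forall i, D i} ->
  let A := pinned qs `&` [set t | F [seq cell nu (X i t) | i <- ps]] in
  measurable A /\
  P A = ((\prod_(x <- qs) p x.2)%:E *
         mean_seq p (size ps) (fun s => (F s)%:R%:E))%E.
Proof.
have p0 : weight p by apply: geometric_weight_ge0; rewrite expR_ge0 /= -expR0
  ler_expR oppr_le0 invr_ge0 ltW.
elim: ps qs F => [|i ps IH] qs F /=.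
  rewrite cats0 => uqs Dqs.
  have -> : pinned qs `&` [set _ | F [::]] = if F [::] then pinned qs else set0.
    case: (F [::]); first by apply/seteqP; split => t //= [].
    by apply/seteqP; split => t //= [].
  case: (F [::]); last by rewrite measure0 mule0; split.
  rewrite mule1 pinned_law //; split => //.
  rewrite (_ : pinned qs = \big[setI/setT]_(x <- qs)
     (X x.1 @^-1` [set y : R | cell nu y = x.2])).
    apply: bigsetI_measurable => x _.
    rewrite -[X in measurable X]setTI; apply: measurable_funP => //.
    exact: (@measurable_cell R nu [set k | k = x.2]).
  rewrite -bigcap_seq; apply/seteqP; split => t.
    by move=> /allP h x /= /h /eqP.
  by move=> h; apply/allP => x /h /= ->.
move=> uqs Dqs.
pose A k := pinned ((i, k) :: qs) `&`
  [set t | F (k :: [seq cell nu (X i t) | i <- ps])].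
have iuqs k : uniq (unzip1 ((i, k) :: qs) ++ ps).
  by rewrite (perm_uniq (s2 := unzip1 qs ++ i :: ps)) //= -cat1s perm_catCA.
have iDqs k : {in unzip1 ((i, k) :: qs) ++ ps, forall i, D i}.
  move=> j jqs; apply: Dqs; move: jqs; rewrite /= !(inE, mem_cat).
  by rewrite orbCA.
have IHk k := IH _ (fun s => F (k :: s)) (iuqs k) (iDqs k).
rewrite (_ : pinned qs `&` _ = \bigcup_k A k); last first.
  apply/seteqP; split => t.
    move=> [/= h Ft]; exists (cell nu (X i t)) => //.
    by split => //; rewrite /pinned /= eqxx.
  by move=> [k _ [/= /andP[/eqP /= <- h] Ft]]; split.
have mA k : measurable (A k) by case: (IHk k).
have mU : measurable (\bigcup_k A k) by exact: bigcupT_measurable.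
split => //.
rewrite measure_semi_bigcup //; last first.
  by move=> j k _ _ [t [[/= /andP[/eqP /= <- _] _] [/andP[/eqP /= <- _] _]]].
rewrite /mean -nneseriesZl; last first.
  move=> k _; apply: mule_ge0; first by rewrite lee_fin p0.
  by apply: mean_seq_ge0 => // s; rewrite lee_fin ler0n.
apply: eq_eseriesr => k _; apply: (etrans (IHk k).2).
by rewrite big_cons /= EFinM -muleA muleCA.
Qed.

Lemma transfer (ps : seq I) (F : seq nat -> bool) :
  uniq ps -> {in ps, forall i, D i} ->
  let A := [set t | F [seq cell nu (X i t) | i <- ps]] in
  measurable A /\
  P A = mean_seq (geometric_weight (expR (- nu^-1))) (size ps)
    (fun s => (F s)%:R%:E).
Proof.
move=> ups Dps; have := @transfer_aux ps [::] F ups Dps.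
rewrite big_nil mul1e (_ : pinned [::] `&` _ =
  [set t | F [seq cell nu (X i t) | i <- ps]]) //.
by apply/seteqP; split => t //= [].
Qed.

End Transfer.

(** * Passage times on the grid *)

Section Grid.
Variable K : nat * nat -> nat.

(** The row comes first and the column second, opposite to the order in the sites
[(i, j)]. The value 0 on the axes encodes the absence of boundary weights. *)
Fixpoint passage_time (j : nat) : nat -> nat :=
  if j is j'.+1 then
    fix go i := if i is i'.+1 then
      (K (i, j) + maxn (go i') (passage_time j' i))%N else 0%N
  else fun=> 0%N.

(** The passage time as a function of the flat list [s] of the weights, row after
row, which is the form in which [transfer] provides them. *)
Fixpoint grid_passage m n (g s : seq nat) : nat :=
  if n is n'.+1 then
    grid_passage m n' (passage_row 0 g (take m s)) (drop m s)
  else last 0%N g.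

Definition grid (j0 m n : nat) : seq (nat * nat) :=
  [seq (i, j) | j <- iota j0.+1 n, i <- iota 1 m].

Lemma passage_time_row j i0 k :
  passage_row (passage_time j.+1 i0)
    [seq passage_time j i | i <- iota i0.+1 k]
    [seq K (i, j.+1) | i <- iota i0.+1 k] =
  [seq passage_time j.+1 i | i <- iota i0.+1 k].
Proof. by elim: k i0 => [|k IH] i0 //=; rewrite -IH. Qed.

Lemma grid_passage_time j0 m n :
  grid_passage m n [seq passage_time j0 i | i <- iota 1 m]
    [seq K x | x <- grid j0 m n] =
  last 0%N [seq passage_time (j0 + n) i | i <- iota 1 m].
Proof.
elim: n j0 => [|n IH] j0; first by rewrite addn0.
rewrite /grid /= map_cat take_size_cat ?drop_size_cat ?size_map ?size_iota //.
rewrite -map_comp (passage_time_row j0 0 m) -/(grid j0.+1 m n).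
by rewrite IH addSnnS.
Qed.

(** No path beats the recursion, since each of its steps picks one of the two terms
of the maximum. *)
Lemma passage_time_path (p : nat * nat) (s : seq (nat * nat)) :
  positive_quadrant p -> path up_right_step p s ->
  (passage_time p.2 p.1 + \sum_(x <- s) K x <=
   passage_time (last p s).2 (last p s).1)%N.
Proof.
elim: s p => [|r s IH] p p0 /=; first by rewrite big_nil addn0.
case/andP=> pr; have r0 : positive_quadrant r.
  by case: p0 => p1 p2; case/orP: pr => /eqP ->.
move=> /(IH _ r0); apply: leq_trans; rewrite big_cons addnA leq_add2r.
case: p pr p0 => [[|i] [|j]] /orP[]/eqP -> [] //= _ _.
- by rewrite addnC leq_add2l leq_maxl.
- by rewrite addnC leq_add2l leq_maxr.
Qed.

End Grid.

Section PassageEvent.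
Variable R : realType.

Lemma size_up_right_path (p : nat * nat) (s : seq (nat * nat)) :
  path up_right_step p s ->
  ((last p s).1 + (last p s).2 = p.1 + p.2 + size s)%N.
Proof.
elim: s p => [|r s IH] p /=; first by rewrite addn0.
by case/andP => /orP[] /eqP -> /IH -> /=; rewrite ?addSn ?addnS.
Qed.

(** Each of the [m + n - 1] sites of a path loses less than [1 / nu] in the
rounding. *)
Lemma last_passage_le_cell (w : nat * nat -> R) (nu : R) m n :
  0 < nu -> (0 < m)%N -> (0 < n)%N ->
  last_passage w m n <=
  (grid_passage m n (nseq m 0%N) [seq cell nu (w x) | x <- grid 0 m n]
   + (m + n))%:R / nu.
Proof.
move=> nu0 m0 n0.
have [[pi [s [-> ps ls]] ->] _] := last_passage_max w m0 n0.
pose K x := cell nu (w x).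
have p0 : positive_quadrant (1, 1)%N by [].
have := passage_time_path K p0 ps; rewrite ls /= => sK.
have := size_up_right_path ps; rewrite ls /= => ssz.
have -> : nseq m 0%N = [seq passage_time K 0 i | i <- iota 1 m].
  by elim: (m) (1%N) => [|k IH] i //=; rewrite -IH.
rewrite (grid_passage_time K 0 m n) add0n.
have -> : last 0%N [seq passage_time K n i | i <- iota 1 m] = passage_time K n m.
  by case: m m0 {ls sK ssz} => // m _; rewrite -nth_last size_map size_iota (nth_map 0%N) ?size_iota // nth_iota.
apply: (@le_trans _ _ (\sum_(x <- (1, 1)%N :: s) ((K x).+1%:R / nu))).
  by apply: ler_sum => x _; exact: le_cell.
rewrite -mulr_suml ler_wpM2r ?invr_ge0 ?(ltW nu0) // -natr_sum ler_nat.
under eq_bigr do rewrite -addn1.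
rewrite big_split /= sum1_size /= big_cons.
move: sK; rewrite max0n; lia.
Qed.

Lemma measurable_last_passage (d : measure_display) (T : measurableType d)
    (P : probability T R) (X : nat * nat -> {RV P >-> R}) m n (c : R) :
  (0 < m)%N -> (0 < n)%N ->
  measurable [set t | c <= last_passage (fun p => X p t) m n].
Proof.
move=> m0 n0; rewrite (_ : [set t | _] =
    \bigcup_(pi in up_right_paths (1, 1)%N (m, n))
      [set t | c <= \sum_(p <- pi) X p t]); last first.
  apply/seteqP; split => t /=.
    have [[pi ppi ->] _] := last_passage_max (fun p => X p t) m0 n0.
    by move=> cpi; exists pi.
  move=> [pi ppi /= /le_trans]; apply.
  by have [_] := last_passage_max (fun p => X p t) m0 n0; apply.
apply: fin_bigcup_measurable; first exact: finite_up_right_paths.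
move=> pi _.
have mf : measurable_fun setT (fun t => \sum_(p <- pi) X p t).
  by apply: measurable_sum => p; exact: measurable_funP.
rewrite (_ : [set t | _] = setT `&` (fun t => \sum_(p <- pi) X p t) @^-1` `[c, +oo[).
  exact: mf.
by rewrite setTI; apply/seteqP; split => t /=; rewrite in_itv /= andbT.
Qed.

Lemma mean_grid_passage (q t : R) m n g :
  mean_seq (geometric_weight q) (n * m)
    (fun s => (expR (t * (grid_passage m n g s)%:R))%:E) =
  passage_mgf q t m n g.
Proof.
elim: n g => [|n IH] g //=.
rewrite mulSn mean_seqD; apply: eq_mean_seq => W sW.
rewrite -IH; apply: eq_mean_seq => s _.
by rewrite take_size_cat // drop_size_cat.
Qed.

Lemma grid_uniq j0 m n : uniq (grid j0 m n).
Proof. by apply: allpairs_uniq; rewrite ?iota_uniq // => -[a b] [c e] _ _ /= [-> ->]. Qed.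

Lemma grid_positive j0 m n : {in grid j0 m n, forall p, positive_quadrant p}.
Proof.
move=> p /allpairsP[[j i] [/=]]; rewrite !mem_iota => /andP[j0j _] /andP[i0 _] ->.
by split => //=; exact: leq_trans j0j.
Qed.

Lemma size_grid j0 m n : size (grid j0 m n) = (n * m)%N.
Proof. by rewrite size_allpairs !size_iota. Qed.

(** Compares the constants of the geometric model with their limits; the factor
[expR x] disappears as [x] goes to 0. *)
Lemma ratio_expR (x y : R) : 0 < x -> 0 <= y ->
  (1 - expR (- y)) / (1 - expR (- x)) <= y / x * expR x.
Proof.
move=> x0 y0.
have ex : expR (- x) < 1 by rewrite -expR0 ltr_expR oppr_lt0.
have hy : 1 - expR (- y) <= y by have := expR_ge1Dx (- y); lra.
have hx : x * expR (- x) <= 1 - expR (- x).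
  have e : expR (- x) * expR x = 1 by rewrite -expRD addNr expR0.
  have := ler_wpM2l (expR_ge0 (- x)) (expR_ge1Dx x); lra.
rewrite ler_pdivrMr ?subr_gt0 //; apply: (le_trans hy).
have yx0 : 0 <= y / x * expR x by rewrite mulr_ge0 ?divr_ge0 ?expR_ge0 ?(ltW x0).
apply: le_trans (ler_wpM2l yx0 hx).
rewrite mulrACA divfK ?gt_eqF // -expRD subrr expR0 mulr1 //.
Qed.

Section Model.
Variables (d : measure_display) (T : measurableType d) (P : probability T R).
Variable X : nat * nat -> {RV P >-> R}.
Hypothesis indep : mutually_independent positive_quadrant X.
Hypothesis law :
  forall p, positive_quadrant p -> has_law (X p) (exponential_prob (1 : R)).
Variables m n : nat.
Hypotheses (m0 : (0 < m)%N) (n0 : (0 < n)%N).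

Lemma chernoff_cell (nu th c : R) : 0 < nu -> 0 <= th ->
  (P [set t | (c <= last_passage (fun p => X p t) m n)%R] <=
   (expR (th * ((m + n)%:R / nu - c))%R)%:E *
   passage_mgf (expR (- nu^-1)) (th / nu) m n (nseq m 0%N))%E.
Proof.
move=> nu0 th0.
pose F s := c <= (grid_passage m n (nseq m 0%N) s + (m + n))%:R / nu.
have [mA PA] := transfer nu0 indep law F (grid_uniq 0 m n)
  (@grid_positive 0 m n).
have q01 : 0 <= expR (- nu^-1) <= (1 : R).
  by rewrite expR_ge0 /= -expR0 ler_expR oppr_le0 invr_ge0 ltW.
have pq := geometric_weight_ge0 q01.
apply: (@le_trans _ _ (P
    [set t | F [seq cell nu (X i t) | i <- grid 0 m n]])).
  apply: le_measure; rewrite ?inE //; first exact: measurable_last_passage.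
  by move=> t /= /le_trans; apply; exact: last_passage_le_cell.
rewrite PA size_grid -mean_grid_passage -mean_seqZl ?expR_ge0 //.
apply: le_mean_seq => [//|s|s]; first by rewrite lee_fin; case: (F s).
move=> _; rewrite -EFinM lee_fin -expRD.
have [Fs|_] := boolP (F s); last by rewrite expR_ge0.
rewrite -[leLHS]expR0 ler_expR.
rewrite (_ : _ + _ =
  th * ((grid_passage m n (nseq m 0%N) s + (m + n))%:R / nu - c)).
  by rewrite mulr_ge0 // subr_ge0.
by rewrite natrD; field; rewrite gt_eqF.
Qed.

(** The limit [nu -> oo] of [chernoff_cell], with [a = expR (- (1 - z) / nu)] and
[b = expR (- z / nu)] as stationary parameters: their product is the parameter
of the discretised weights. *)
Lemma chernoff_passage (w z c : R) : 0 < z -> z <= w -> w < 1 ->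
  (P [set t | (c <= last_passage (fun p => X p t) m n)%R] <=
   (expR (- ((w - z) * c)) * (w / z) ^+ m * ((1 - z) / (1 - w)) ^+ n)%:E)%E.
Proof.
move=> z0 zw w1.
set B := _ * _ * _.
pose C := (w - z) * (m + n)%:R + z * m%:R + (1 - w) * n%:R.
have bound nu : 0 < nu ->
  (P [set t | (c <= last_passage (fun p => X p t) m n)%R] <= (B * expR (C / nu))%:E)%E.
  move=> nu0.
  have th0 : 0 <= w - z by rewrite subr_ge0.
  apply: (le_trans (chernoff_cell c nu0 th0)).
  have w0 := lt_le_trans z0 zw; have z1 := le_lt_trans zw w1.
  pose a := expR (- ((1 - z) / nu)); pose b := expR (- (z / nu)).
  have e01 x : 0 < x -> 0 <= expR (- (x / nu)) < 1.
    by move=> x0; rewrite expR_ge0 /= -expR0 ltr_expR oppr_lt0 divr_gt0.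
  have eat : a * expR ((w - z) / nu) = expR (- ((1 - w) / nu)).
    by rewrite -expRD; congr expR; field; rewrite gt_eqF.
  have ebt : b * expR (- ((w - z) / nu)) = expR (- (w / nu)).
    by rewrite -expRD; congr expR; field; rewrite gt_eqF.
  have eab : a * b = expR (- nu^-1).
    by rewrite -expRD; congr expR; field; rewrite gt_eqF.
  have t0 : 0 <= (w - z) / nu by rewrite divr_ge0 // ltW.
  have a01 : 0 <= a < 1 by apply: e01; rewrite subr_gt0.
  have b01 : 0 <= b < 1 by exact: e01.
  have at01 : 0 <= a * expR ((w - z) / nu) < 1.
    by rewrite eat e01 // subr_gt0.
  have := passage_mgf_le m n t0 a01 b01 at01.
  rewrite eab eat ebt => mgf.
  apply: (le_trans (lee_wpmul2l _ mgf)); first by rewrite lee_fin expR_ge0.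
  rewrite -EFinM lee_fin.
  have r1 := @ratio_expR (z / nu) (w / nu) (divr_gt0 z0 nu0) (divr_ge0 (ltW w0) (ltW nu0)).
  have r2 := @ratio_expR ((1 - w) / nu) ((1 - z) / nu)
    (divr_gt0 (etrans (subr_gt0 _ _) w1) nu0)
    (divr_ge0 (ltW (etrans (subr_gt0 _ _) z1)) (ltW nu0)).
  have cancel_nu x y : y != 0 -> x / nu / (y / nu) = x / y.
    by move=> y0; field; rewrite y0 gt_eqF.
  rewrite cancel_nu ?gt_eqF // in r1.
  rewrite cancel_nu ?gt_eqF ?subr_gt0 // in r2.
  have p1 : 0 <= (1 - expR (- (w / nu))) / (1 - b).
    by rewrite divr_ge0 ?subr_ge0 // ltW //; [case/andP: (e01 w w0)|case/andP: b01].
  have p2 : 0 <= (1 - a) / (1 - expR (- ((1 - w) / nu))).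
    have w1' : 0 < 1 - w by rewrite subr_gt0.
    by rewrite divr_ge0 ?subr_ge0 // ltW //; [case/andP: a01|case/andP: (e01 _ w1')].
  have q1 := lerXn2r m p1 (le_trans p1 r1) r1.
  have q2 := lerXn2r n p2 (le_trans p2 r2) r2.
  apply: (le_trans (ler_wpM2l (expR_ge0 _) (ler_pM (exprn_ge0 m p1) (exprn_ge0 n p2) q1 q2))).
  rewrite /B [(w / z * _) ^+ m]exprMn [((1 - z) / (1 - w) * _) ^+ n]exprMn -!expRM_natl.
  set A1 := (w / z) ^+ m; set A2 := _ ^+ n.
  rewrite le_eqVlt; apply/orP; left; apply/eqP.
  transitivity (A1 * A2 * (expR ((w - z) * ((m + n)%:R / nu - c)) *
    expR (m%:R * (z / nu)) * expR (n%:R * ((1 - w) / nu)))); first by ring.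
  transitivity (A1 * A2 * (expR (- ((w - z) * c)) * expR (C / nu))); last by ring.
  by rewrite -!expRD; congr (_ * expR _); rewrite /C; field; rewrite gt_eqF.
have B0 : 0 < B.
  have w0 := lt_le_trans z0 zw; have z1 := le_lt_trans zw w1.
  by rewrite /B !mulr_gt0 ?expR_gt0 ?exprn_gt0 ?divr_gt0 ?subr_gt0.
have C0 : 0 <= C.
  have w0 := lt_le_trans z0 zw.
  by rewrite /C !addr_ge0 ?mulr_ge0 ?ler0n ?subr_ge0 // ltW.
have finP := fin_num_measure P _ (measurable_last_passage X c m0 n0).
move: bound; rewrite -(fineK finP) lee_fin; set r := fine _ => bound.
rewrite leNgt; apply/negP => Br.
have rB : 1 < r / B by rewrite ltr_pdivlMr // mul1r.
pose de := ln (r / B); have de0 : 0 < de by exact: ln_gt0.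
(* For this [nu] the rounding factor [expR (C / nu)] is below [r / B]. *)
have := bound ((C + 1) / de) (divr_gt0 (ltr_wpDl C0 ltr01) de0).
rewrite lee_fin leNgt => /negP; apply.
have -> : r = B * expR de.
  by rewrite lnK ?posrE ?(lt_trans ltr01) // mulrC divfK ?gt_eqF.
rewrite ltr_pM2l // ltr_expR invfM invrK mulrA mulrAC ltr_pdivrMr; last lra.
by rewrite mulrDr mulr1 (mulrC C) ltrDl.
Qed.

End Model.
End PassageEvent.

(** * Expansion of the exponent *)

Section Expansion.
Variable R : realType.

Lemma ln_ratio_le (u : R) : 0 <= u <= 2^-1 ->
  ln ((1 + u) / (1 - u)) <= 2 * u + 2 / 3 * u ^+ 3 + u ^+ 5.
Proof.
move=> /andP[u0 u2].
pose f (x : R) := 2 * x + 2 / 3 * x ^+ 3 + x ^+ 5 - ln (1 + x) + ln (1 - x).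
have df (x : R) : 0 <= x <= 2^-1 ->
    is_derive x 1 f (2 + 2 * x ^+ 2 + 5 * x ^+ 4 - (1 + x)^-1 - (1 - x)^-1).
  move=> /andP[x0 x2].
  have p1 : 0 < 1 + x by lra.
  have p2 : 0 < 1 - x by lra.
  have d1 : is_derive x 1 (fun y : R => ln (1 + y)) (1 + x)^-1.
    have h : is_derive x 1 (fun y : R => 1 + y) 1.
      by apply: is_derive_eq; rewrite add0r mulr1.
    by have := is_derive1_comp (is_derive1_ln p1) h; rewrite mulr1.
  have d2 : is_derive x 1 (fun y : R => ln (1 - y)) (- (1 - x)^-1).
    have h : is_derive x 1 (fun y : R => 1 - y) (- 1).
      by apply: is_derive_eq; rewrite add0r mul1r.
    by have := @is_derive1_comp R (@ln R) (fun y => 1 - y) x _ _ (is_derive1_ln p2) h; rewrite mulrN1.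
  apply: is_derive_eq; rewrite ?[_%:A]mulr1 /GRing.scale /=.
  by congr (_ - _ - _); field.
have : f 0 <= f u.
  apply: (@ger0_derive1_le_cc _ f 0 2^-1).
  - move=> x; rewrite in_itv /= => /andP[x0 x2].
    by have [] := df x (introT andP (conj (ltW x0) (ltW x2))).
  - move=> x; rewrite in_itv /= => /andP[x0 x2].
    rewrite derive1E; have [_ ->] := df x (introT andP (conj (ltW x0) (ltW x2))).
    have p1 : 0 < 1 + x by lra.
    have p2 : 0 < 1 - x by lra.
    (* Since [1/(1+x) + 1/(1-x) = 2/(1-x^2)]; nonnegative as [x^2 <= 1/4]. *)
    rewrite (_ : _ - _ = (x ^+ 2) ^+ 2 * (3 - 5 * x ^+ 2) / ((1 + x) * (1 - x))).
      by rewrite divr_ge0 ?mulr_ge0 ?sqr_ge0 ?(ltW p1) ?(ltW p2) //; nra.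
    by field; rewrite !gt_eqF.
  - apply: continuous_in_subspaceT => x; rewrite inE /= in_itv /= => /df [dx _].
    by apply/differentiable_continuous/derivable1_diffP.
  - by rewrite in_itv /= lexx; lra.
  - by rewrite in_itv /= u0.
  - by [].
have -> : f 0 = 0 by rewrite /f addr0 subr0 ln1; ring.
have p1 : 0 < 1 + u by lra.
have p2 : 0 < 1 - u by lra.
rewrite ln_div ?posrE // /f => h; lra.
Qed.

(** With [a = sqrt m], [b = sqrt n], [y = sqrt s] and [rho = a / (a + b)], the
numbers [u] and [v] are [e / rho] and [e / (1 - rho)], so that the two
logarithms are those of [w / z] and [(1 - z) / (1 - w)] for [w, z = rho +- e]. *)
Lemma rate_le (a b sg y : R) : 0 < a -> 0 < b -> 0 < sg -> 0 <= y ->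
  sg ^+ 3 = (a + b) ^+ 4 / (a * b) ->
  let e := y / sg in
  let u := e * (a + b) / a in let v := e * (a + b) / b in
  u <= 2^-1 -> v <= 2^-1 ->
  - (2 * e * ((a + b) ^+ 2 + sg * y ^+ 2)) + a ^+ 2 * ln ((1 + u) / (1 - u))
    + b ^+ 2 * ln ((1 + v) / (1 - v)) <=
  - (4 * y ^+ 3 / 3) + (a ^+ 2 * u ^+ 5 + b ^+ 2 * v ^+ 5).
Proof.
move=> a0 b0 sg0 y0 sg3 e u v u2 v2.
have ab0 : 0 < a + b by exact: addr_gt0.
have e0 : 0 <= e by rewrite divr_ge0 // (ltW sg0).
have u0 : 0 <= u by exact: divr_ge0 (mulr_ge0 e0 (ltW ab0)) (ltW a0).
have v0 : 0 <= v by exact: divr_ge0 (mulr_ge0 e0 (ltW ab0)) (ltW b0).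
have lu : ln ((1 + u) / (1 - u)) <= 2 * u + 2 / 3 * u ^+ 3 + u ^+ 5.
  by apply: ln_ratio_le; rewrite u0.
have lv : ln ((1 + v) / (1 - v)) <= 2 * v + 2 / 3 * v ^+ 3 + v ^+ 5.
  by apply: ln_ratio_le; rewrite v0.
have au := ler_wpM2l (sqr_ge0 a) lu.
have bv := ler_wpM2l (sqr_ge0 b) lv.
have lin : a ^+ 2 * (2 * u) + b ^+ 2 * (2 * v) = 2 * e * (a + b) ^+ 2.
  by rewrite /u /v; field; rewrite !gt_eqF.
have cub : a ^+ 2 * u ^+ 3 + b ^+ 2 * v ^+ 3 = y ^+ 3.
  transitivity (e ^+ 3 * ((a + b) ^+ 4 / (a * b))).
    by rewrite /u /v; field; rewrite !gt_eqF.
  by rewrite -sg3 -exprMn divfK // gt_eqF.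
have sy : e * (sg * y ^+ 2) = y ^+ 3.
  by rewrite /e; field; rewrite gt_eqF.
lra.
Qed.

(** In the cone, [rho] and [1 - rho] are at least [k], and [sg] is at least
[L = (m + n)^(1/3)]; hence [u] and [v] are at most [y / (L k)]. The bound on [y]
makes this at most 1/2, and spends one of the five powers of [y]. *)
Lemma quintic_le (de a b sg y L : R) : 0 < de -> 0 < a -> 0 < b ->
  0 < L -> 0 <= y -> L ^+ 3 = a ^+ 2 + b ^+ 2 ->
  sg ^+ 3 = (a + b) ^+ 4 / (a * b) -> 0 < sg ->
  de * b <= a -> de * a <= b ->
  let k := de / (1 + de) in
  y <= k / 2 * L ->
  let u := y / sg * (a + b) / a in let v := y / sg * (a + b) / b in
  [/\ u <= 2^-1, v <= 2^-1 &
  a ^+ 2 * u ^+ 5 + b ^+ 2 * v ^+ 5 <= (2 * k ^+ 4)^-1 * y ^+ 4 / L].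
Proof.
move=> de0 a0 b0 L0 y0 L3 sg3 sg0 ba ab k yL u v.
have ab0 : 0 < a + b by exact: addr_gt0.
have k0 : 0 < k by rewrite divr_gt0 // addr_gt0.
have Lsg : L <= sg.
  rewrite -(@ler_pXn2r _ 3) ?nnegrE ?(ltW L0) ?(ltW sg0) // L3 sg3.
  rewrite ler_pdivlMr ?mulr_gt0 //.
  have := mulr_gt0 a0 b0; nra.
have ka : (a + b) / a <= k^-1.
  by rewrite ler_pdivrMr // /k invf_div mulrAC ler_pdivlMr //; lra.
have kb : (a + b) / b <= k^-1.
  by rewrite ler_pdivrMr // /k invf_div mulrAC ler_pdivlMr //; lra.
have e0 : 0 <= y / sg by rewrite divr_ge0 // (ltW sg0).
have eL : y / sg <= y / L.
  by rewrite ler_wpM2l // lef_pV2.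
have ek : y / L <= k / 2 by rewrite ler_pdivrMr.
have k20 : 0 <= k^-1 by rewrite invr_ge0 ltW.
have uk : u <= y / L / k.
  rewrite /u -mulrA; apply: ler_pM => //.
  exact: divr_ge0 (ltW ab0) (ltW a0).
have vk : v <= y / L / k.
  rewrite /v -mulrA; apply: ler_pM => //.
  exact: divr_ge0 (ltW ab0) (ltW b0).
have half : y / L / k <= 2^-1.
  by rewrite ler_pdivrMr // (mulrC 2^-1).
split; [exact: le_trans half|exact: le_trans half|].
have u0 : 0 <= u by exact: divr_ge0 (mulr_ge0 e0 (ltW ab0)) (ltW a0).
have v0 : 0 <= v by exact: divr_ge0 (mulr_ge0 e0 (ltW ab0)) (ltW b0).
set q := y / L / k in uk vk half.
have q0 : 0 <= q by apply: le_trans uk.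
have u5 : u ^+ 5 <= q ^+ 5 by apply: lerXn2r; rewrite ?nnegrE.
have v5 : v ^+ 5 <= q ^+ 5 by apply: lerXn2r; rewrite ?nnegrE.
apply: (@le_trans _ _ (L ^+ 3 * q ^+ 5)).
  by rewrite L3 mulrDl lerD // ler_wpM2l // sqr_ge0.
rewrite (exprS q 4) (_ : _ * _ / L = L ^+ 3 * (2^-1 * q ^+ 4)).
  by rewrite ler_wpM2l ?exprn_ge0 ?(ltW L0) // ler_wpM2r // exprn_ge0.
by rewrite /q; field; rewrite !gt_eqF.
Qed.

Lemma powR_expr (x p : R) n : 0 <= x -> (x `^ p) ^+ n = x `^ (p * n%:R).
Proof. by move=> x0; rewrite -powR_mulrn ?powR_ge0 // -powRrM. Qed.

Lemma sigma_cube (x y : R) : 0 < x -> 0 < y ->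
  sigma x y ^+ 3 =
  (Num.sqrt x + Num.sqrt y) ^+ 4 / (Num.sqrt x * Num.sqrt y).
Proof.
move=> x0 y0; rewrite /sigma exprMn exprVn exprMn.
rewrite !powR_expr ?addr_ge0 ?sqrtr_ge0 ?(ltW x0) ?(ltW y0) //.
have -> : 4 / 3 * 3%:R = 4%:R :> R by field.
have -> : 1 / 6 * 3%:R = 2^-1 :> R by field.
by rewrite !powR12_sqrt ?(ltW x0) ?(ltW y0) // powR_mulrn // addr_ge0 ?sqrtr_ge0.
Qed.

Lemma sigma_gt0 (x y : R) : 0 < x -> 0 < y -> 0 < sigma x y.
Proof.
move=> x0 y0.
by rewrite divr_gt0 ?mulr_gt0 ?powR_gt0 // addr_gt0 // sqrtr_gt0.
Qed.

Lemma lne_le_EFin (x : \bar R) (r : R) : (0 <= x)%E -> (x <= (expR r)%:E)%E ->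
  (lne x <= r%:E)%E.
Proof.
move=> x0 xr; have -> : r%:E = lne (expR r)%:E by rewrite lne_EFin ?expR_gt0 // expRK.
by rewrite lee_lne // in_itv /= ?x0 ?leey // lee_fin expR_ge0.
Qed.

End Expansion.

Theorem theorem2p2 (R : realType) (delta : R) (delta_gt0 : 0 < delta) :
  exists c0 C0 : R, 0 < c0 /\ 0 < C0 /\
    forall (d : measure_display) (T : measurableType d) (P : probability T R)
      (omega : nat * nat -> {RV P >-> R}),
      mutually_independent positive_quadrant omega ->
      (forall p : nat * nat, positive_quadrant p ->
         has_law (omega p) (exponential_prob (1 : R))) ->
      forall (m n : nat) (s : R),
        (0 < m)%N -> (0 < n)%N -> cone delta (m%:R, n%:R) ->
        0 <= s -> s <= c0 * (m + n)%:R `^ (2 / 3) ->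
        (lne (P [set t | gamma m%:R n%:R + sigma m%:R n%:R * s
                         <= last_passage (fun p => omega p t) m n]%R)
         <= (- (4 * s `^ (3 / 2) / 3)
             + C0 * s ^+ 2 / (m + n)%:R `^ (1 / 3))%R%:E)%E.
Proof.
pose de := Num.sqrt delta; have de0 : 0 < de by rewrite sqrtr_gt0.
pose k := de / (1 + de); have k0 : 0 < k by rewrite divr_gt0 // addr_gt0.
exists ((k / 2) ^+ 2), (2 * k ^+ 4)^-1; split; first by rewrite exprn_gt0 // divr_gt0.
split; first by rewrite invr_gt0 mulr_gt0 // exprn_gt0.
move=> d T P omega indep law m n s m0 n0 [/= m0' n0' nm mn] s0 sN.
pose a : R := Num.sqrt m%:R; pose b : R := Num.sqrt n%:R.
have a0 : 0 < a by rewrite sqrtr_gt0.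
have b0 : 0 < b by rewrite sqrtr_gt0.
have ab0 : 0 < a + b by exact: addr_gt0.
have a2 : a ^+ 2 = m%:R by rewrite sqr_sqrtr ?ltW.
have b2 : b ^+ 2 = n%:R by rewrite sqr_sqrtr ?ltW.
pose L : R := (m + n)%:R `^ (1 / 3).
have N0 : 0 < (m + n)%:R :> R by rewrite ltr0n addn_gt0 m0.
have L0 : 0 < L by exact: powR_gt0.
have L3 : L ^+ 3 = a ^+ 2 + b ^+ 2.
  rewrite a2 b2 -natrD powR_expr ?(ltW N0) // (_ : 1 / 3 * 3%:R = 1 :> R); last by field.
  by rewrite powRr1 ?(ltW N0).
have L2 : (m + n)%:R `^ (2 / 3) = L ^+ 2.
  by rewrite powR_expr ?(ltW N0) //; congr powR; field.
pose y := Num.sqrt s; have y0 : 0 <= y by exact: sqrtr_ge0.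
have y2 : y ^+ 2 = s by rewrite sqr_sqrtr.
have y3 : s `^ (3 / 2) = y ^+ 3.
  by rewrite /y -powR12_sqrt // powR_expr //; congr powR; field.
have yL : y <= k / 2 * L.
  have kL0 : 0 <= k / 2 * L.
    by apply: mulr_ge0; [apply: divr_ge0; first exact: ltW|exact: ltW].
  rewrite -(@ler_pXn2r _ 2) ?nnegrE //.
  by rewrite exprMn y2 -L2.
pose sg : R := sigma m%:R n%:R.
have sg0 : 0 < sg by exact: sigma_gt0.
have sg3 : sg ^+ 3 = (a + b) ^+ 4 / (a * b) by exact: sigma_cube.
have ba : de * b <= a by rewrite /de /a /b -sqrtrM ?ler_sqrt ?mulr_gt0 // ltW.
have ab : de * a <= b by rewrite /de /a /b -sqrtrM ?ler_sqrt ?mulr_gt0 // ltW.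
have [] := quintic_le de0 a0 b0 L0 y0 L3 sg3 sg0 ba ab yL.
pose e := y / sg; rewrite -/e -/k.
pose u := e * (a + b) / a; pose v := e * (a + b) / b; rewrite -/u -/v => u2 v2 quint.
have := rate_le a0 b0 sg0 y0 sg3 u2 v2; rewrite -/e -/u -/v => rate.
have e0 : 0 <= e by rewrite divr_ge0 // (ltW sg0).
pose rho := a / (a + b).
pose w := rho + e; pose z := rho - e.
have hz : z = rho * (1 - u) by rewrite /z /rho /u; field; rewrite !gt_eqF.
have hw : w = rho * (1 + u) by rewrite /w /rho /u; field; rewrite !gt_eqF.
have hz1 : 1 - z = b / (a + b) * (1 + v).
  by rewrite /z /rho /v; field; rewrite !gt_eqF.
have hw1 : 1 - w = b / (a + b) * (1 - v).
  by rewrite /w /rho /v; field; rewrite !gt_eqF.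
have rho0 : 0 < rho by rewrite divr_gt0.
have rho1 : 0 < b / (a + b) by rewrite divr_gt0.
have u0 : 0 <= u by exact: divr_ge0 (mulr_ge0 e0 (ltW ab0)) (ltW a0).
have v0 : 0 <= v by exact: divr_ge0 (mulr_ge0 e0 (ltW ab0)) (ltW b0).
have z0 : 0 < z by rewrite hz mulr_gt0 //; lra.
have zw : z <= w by rewrite /z /w; lra.
have w1 : w < 1 by rewrite -subr_gt0 hw1 mulr_gt0 //; lra.
have wz : w / z = (1 + u) / (1 - u).
  by rewrite hw hz -mulf_div divff ?mul1r // gt_eqF.
have zw1 : (1 - z) / (1 - w) = (1 + v) / (1 - v).
  by rewrite hz1 hw1 -mulf_div divff ?mul1r // gt_eqF.
apply: lne_le_EFin => //.
apply: (le_trans (chernoff_passage indep law m0 n0 _ z0 zw w1)).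
rewrite lee_fin wz zw1.
have pu : 0 < (1 + u) / (1 - u) by rewrite divr_gt0 //; lra.
have pv : 0 < (1 + v) / (1 - v) by rewrite divr_gt0 //; lra.
rewrite -{1}(lnK pu) -{1}(lnK pv) -!expRM_natl -!expRD ler_expR.
rewrite (_ : gamma _ _ + _ = (a + b) ^+ 2 + sg * y ^+ 2); last by rewrite y2.
rewrite -a2 -b2 y3 -y2.
have we : w - z = 2 * e by rewrite /w /z; ring.
rewrite we; apply: (le_trans rate); rewrite lerD2l.
by rewrite -exprM.
Qed.
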